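(* Let $\Lambda$ be a lattice in an $n$-dimensional Euclidean space $W$ with minimal norm $\mu$ (the minimum of $x\cdot x$ over nonzero $x\in\Lambda$). Let $W=U\oplus V$ be an orthogonal direct sum with $\dim U=k$, $\dim V=l$, $n=k+l$, and suppose that $K:=\Lambda\cap U$ is a lattice of rank $k$ and $L:=\Lambda\cap V$ is a lattice of rank $l$. Let $\pi_U,\pi_V$ be the orthogonal projections of $W$ onto $U$ and $V$, and put $M:=\pi_U(\Lambda)$. Let $S=\{u_1,\dots,u_s\}$ be a set of $s$ distinct points of $M$ and $\beta$ a constant with $0\le\beta<\mu$ such that $|u_i-u_j|^2\le\beta$ for all $i,j$. Define $$\mathcal{A}(S)=\{\pi_V(w): w\in\Lambda,\ \pi_U(w)\in S\}\subset V.$$ Then the spheres of radius $\rho=\tfrac12\sqrt{\mu-\beta}$ centered at the points of $\mathcal{A}(S)$ form an $l$-dimensional sphere packing (their interiors are pairwise disjoint), and this packing has center density $$\delta=\frac{s\,\rho^{l}}{\sqrt{\det L}}.$$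
   Context: $\det L$ denotes the determinant of a Gram matrix of a basis of $L$ (the square of the volume of a fundamental domain of $L$ in $V$). For a packing of equal spheres of radius $\rho$ in $\mathbb{R}^l$ whose set of centers is a finite union of translates of a full-rank lattice $L$, the center density is $N\rho^l/\sqrt{\det L}$, where $N$ is the number of distinct cosets of $L$ (i.e. the number of centers per fundamental domain of $L$); equivalently, it is the density of the packing divided by the volume of the unit ball in $\mathbb{R}^l$. *)

(* Defs.v *)
From mathcomp Require Import all_boot all_order all_algebra.
From mathcomp Require Import finmap all_classical all_reals.

Set Implicit Arguments.
Unset Strict Implicit.
Unset Printing Implicit Defensive.

Import Order.TTheory GRing.Theory Num.Theory.
Local Open Scope classical_set_scope.
Local Open Scope ring_scope.

(* A Euclidean space is a finite-dimensional real vector space W with a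
   positive definite symmetric bilinear form dot : {dot W for idfun}. *)

Section Lattices.
Variables (R : realType) (W : vectType R) (dot : {dot W for idfun}).
Implicit Types (L : set W) (U V : {vspace W}).

Definition enorm (x : W) : R := Num.sqrt (dot x x).

Definition orthoproj U : 'End(W) := daddv_pi U (orthov dot U).

Definition zspan r (B : r.-tuple W) : set W :=
  [set x | exists c : 'I_r -> int, x = \sum_(i < r) B`_i *~ c i].

Definition lattice_basis r (B : r.-tuple W) L : Prop :=
  free B /\ L = zspan B.

Definition is_lattice r L : Prop := exists B : r.-tuple W, lattice_basis B L.

Definition minimal_norm L (mu : R) : Prop :=
  (exists x, [/\ L x, x != 0 & dot x x = mu]) /\
  (forall x, L x -> x != 0 -> mu <= dot x x).

Definition gram r (B : r.-tuple W) : 'M[R]_r :=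
  \matrix_(i, j) dot B`_i B`_j.

(* This does not depend on the basis, see lattice_detE. *)
Definition lattice_det L : R :=
  xget 0 [set d | exists r (B : r.-tuple W), lattice_basis B L /\ d = \det (gram B)].

Definition translate (x : W) L : set W := [set x + y | y in L].

Definition open_ball V (rho : R) (x : W) : set W :=
  [set y | y \in V /\ enorm (y - x) < rho].

Definition sphere_packing V (A : set W) (rho : R) : Prop :=
  [/\ 0 < rho, A `<=` [set x | x \in V] & trivIset A (open_ball V rho)].

Definition periodic V L (A : set W) : Prop :=
  [/\ is_lattice (\dim V) L, L `<=` [set x | x \in V]
    & exists2 T : set W, finite_set T & A = \bigcup_(t in T) translate t L].

(* The number of distinct cosets of L making up A; it is meaningful only when
   that number is finite, which periodic V L A guarantees. *)
Definition num_cosets L (A : set W) : nat :=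
  #|` fset_set [set translate x L | x in A]|.

Definition center_density V L (A : set W) (rho : R) : R :=
  (num_cosets L A)%:R * rho ^+ \dim V / Num.sqrt (lattice_det L).

Definition section_centers U V (Lambda S : set W) : set W :=
  [set orthoproj V w | w in [set w | Lambda w /\ S (orthoproj U w)]].

Lemma zspan_nth r (B : r.-tuple W) (i : 'I_r) : zspan B B`_i.
Proof.
exists (fun j => (j == i)%:Z).
rewrite (bigD1 i) //= eqxx mulr1z big1 ?addr0 // => j /negPf ->.
by rewrite mulr0z.
Qed.

Lemma zspan_span r (B : r.-tuple W) x : zspan B x -> x \in <<B>>%VS.
Proof.
case=> c ->; apply: rpred_sum => i _; apply: rpredMz.
by apply: memv_span; rewrite mem_nth ?size_tuple.
Qed.

Lemma zspan_sub_span r r' (B : r.-tuple W) (B' : r'.-tuple W) :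
  zspan B `<=` zspan B' -> (<<B>> <= <<B'>>)%VS.
Proof.
move=> sBB'; apply/span_subvP => x /(nthP 0)[i]; rewrite size_tuple => ir <-.
exact/zspan_span/sBB'/(zspan_nth B (Ordinal ir)).
Qed.

Lemma lattice_basis_unimodular r (B B' : r.-tuple W) :
  free B -> zspan B = zspan B' ->
  exists P : 'M[int]_r, (\det P) ^+ 2 = 1 /\
    gram B' = map_mx intr P *m gram B *m (map_mx intr P)^T.
Proof.
move=> fB eqBB'.
have coef (C D : r.-tuple W) : zspan C = zspan D ->
    exists P : 'M[int]_r, forall i : 'I_r, D`_i = \sum_(j < r) (P i j)%:~R *: C`_j.
  move=> eqCD.
  have /choice[f Hf] (i : 'I_r) : exists c : 'I_r -> int,
      D`_i = \sum_(j < r) C`_j *~ c j.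
    by have := zspan_nth D i; rewrite -eqCD.
  exists (\matrix_(i, j) f i j) => i; rewrite Hf.
  by apply: eq_bigr => j _; rewrite mxE scaler_int.
have [P HP] := coef B B' eqBB'.
have [Q HQ] := coef B' B (esym eqBB').
exists P; split; last first.
  apply/matrixP => i j; rewrite !mxE (HP j) linear_sumr /=.
  apply: eq_bigr => b _; rewrite !mxE linearZr_LR /= mulrC; congr (_ * _).
  rewrite (HP i) linear_sumlz /=; apply: eq_bigr => a _.
  by rewrite linearZl_LR !mxE.
have QP : Q *m P = 1%:M.
  apply/matrixP => i j; apply: (@intr_inj R); rewrite !mxE.
  have key : \sum_(k < r) ((Q *m P) i k - (i == k)%:Z)%:~R *: B`_k = 0.
    under eq_bigr do rewrite rmorphB scalerBl.
    rewrite sumrB; apply/eqP; rewrite subr_eq0; apply/eqP.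
    rewrite [RHS](bigD1 i) //= eqxx scale1r [X in _ + X]big1; last first.
      by move=> k /negPf; rewrite eq_sym => ->; rewrite scale0r.
    rewrite addr0 [RHS]HQ.
    under [RHS]eq_bigr do rewrite HP scaler_sumr.
    rewrite exchange_big; apply: eq_bigr => k _ /=.
    rewrite mxE rmorph_sum scaler_suml; apply: eq_bigr => m _.
    by rewrite scalerA rmorphM.
  move/freeP: fB => /(_ _ key j); rewrite mxE rmorphB /= => /eqP.
  by rewrite subr_eq0 => /eqP ->; case: (i == j).
have detQP : \det Q * \det P = 1 by rewrite -det_mulmx QP det1.
have : \det P \is a GRing.unit by apply/unitrPr; exists (\det Q); rewrite mulrC.
by rewrite qualifE => /orP[]/eqP ->.
Qed.

Lemma gram_det_unique L r r' (B : r.-tuple W) (B' : r'.-tuple W) :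
  lattice_basis B L -> lattice_basis B' L -> \det (gram B) = \det (gram B').
Proof.
move=> [fB LB] [fB' LB']; have eqBB' : zspan B = zspan B' by rewrite -LB.
have rr' : r = r'.
  have eqS : (<<B>> = <<B'>>)%VS.
    by apply/eqP; rewrite eqEsubv !zspan_sub_span // eqBB'.
  move: fB fB'; by rewrite /free eqS !size_tuple => /eqP dB /eqP dB'; rewrite -dB dB'.
case: _ / rr' B' fB' LB' eqBB' => B' _ _ eqBB'.
have [P [detP ->]] := lattice_basis_unimodular fB eqBB'.
rewrite !det_mulmx det_tr det_map_mx mulrAC -expr2 -rmorphXn detP.
by rewrite rmorph1 mul1r.
Qed.

Lemma lattice_detE L r (B : r.-tuple W) :
  lattice_basis B L -> lattice_det L = \det (gram B).
Proof.
move=> bB; rewrite /lattice_det.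
case: xgetP => [d _ [r' [B' [bB' ->]]]|/(_ (\det (gram B)))[]].
  exact: gram_det_unique bB' bB.
by exists r, B.
Qed.

End Lattices.

(* Main.v *)
(* Orthogonality splits the norm of a lattice vector w into |pU w|^2 + |pV w|^2.
   If w <> w' in Lambda both project into S, then mu <= |w - w'|^2 and the U-part
   contributes at most beta, so |pV w - pV w'|^2 >= mu - beta = (2 rho)^2.
   Lattice vectors over the same point of S differ by elements of L, so each
   u_i contributes one coset of L.  Two such cosets cannot coincide: a lift of u_i
   and a lift of u_j with equal V-parts would differ by u_i - u_j, a nonzero
   lattice vector of norm at most beta < mu. *)
Require Import Defs.
From mathcomp Require Import all_boot all_order all_algebra.
From mathcomp Require Import finmap all_classical all_reals.
From mathcomp Require Import lra.

Import Order.TTheory GRing.Theory Num.Theory.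
Local Open Scope classical_set_scope.
Local Open Scope ring_scope.

Set Implicit Arguments.
Unset Strict Implicit.

Section EuclideanSpace.
Variables (R : realType) (W : vectType R) (dot : {dot W for idfun}).
Implicit Types (L : set W) (U V : {vspace W}) (x y z : W).

Lemma dot_gt0 x : x != 0 -> 0 < dot x x.
Proof. exact: neq0_dnorm_gt0. Qed.

Lemma dot_ge0 x : 0 <= dot x x.
Proof. by have [->|/dot_gt0/ltW//] := eqVneq x 0; rewrite linear0r. Qed.

Lemma enorm_sqr x : enorm dot x ^+ 2 = dot x x.
Proof. exact/sqr_sqrtr/dot_ge0. Qed.

Lemma dot_parallelogram x y :
  dot (x + y) (x + y) + dot (x - y) (x - y) = 2 * dot x x + 2 * dot y y.
Proof. by rewrite hnormD hnormB /=; lra. Qed.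

(** Write [x] orthogonal to [U] as [a + b]; pairing it with its own component [a] leaves
    [dot a a = 0], so [a = 0] by definiteness. This turns [orthoproj], defined through [orthov],
    into the projection along the given other summand. *)
Lemma orthov_complement U V :
  (U + V)%VS = fullv -> (U <= orthov dot V)%VS -> orthov dot U = V.
Proof.
move=> UVfull UV; apply/eqP; rewrite eqEsubv [X in _ && X]orthov_sym UV andbT.
apply/subvP => x /mem_orthovP xU.
have /memv_addP[a aU [b bV xE]] : x \in (U + V)%VS by rewrite UVfull memvf.
suff a0 : a = 0 by rewrite xE a0 add0r.
have := xU a aU; rewrite xE linearDl /=.
have -> : dot b a = 0.
  by move/orthovP: UV => /(_ a b aU bV) ab; rewrite hermC ab /= mulr0.
rewrite addr0 => aa; apply/eqP/negPn/negP => /dot_gt0.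
by rewrite aa ltxx.
Qed.

Lemma is_lattice0 r L : is_lattice r L -> L 0.
Proof.
case=> B [_ ->]; exists (fun=> 0).
by rewrite big1 // => i _; rewrite mulr0z.
Qed.

Lemma is_latticeB r L x y : is_lattice r L -> L x -> L y -> L (x - y).
Proof.
case=> B [_ ->] [c ->] [d ->]; exists (fun i => c i - d i).
by rewrite -sumrB; apply: eq_bigr => i _; rewrite mulrzBr.
Qed.

Lemma is_latticeD r L x y : is_lattice r L -> L x -> L y -> L (x + y).
Proof.
move=> latL Lx Ly; rewrite -[y]opprK -[- y]sub0r.
exact: is_latticeB latL Lx (is_latticeB latL (is_lattice0 latL) Ly).
Qed.

Lemma translate_eqP r L x y :
  is_lattice r L -> translate x L = translate y L <-> L (x - y).
Proof.
move=> latL; split=> [eqxy|Lxy].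
  have : translate x L x by exists 0; [apply: is_lattice0 latL|rewrite addr0].
  by rewrite eqxy => -[z Lz <-]; rewrite addrAC subrr add0r.
apply/seteqP; split=> _ [z Lz <-].
  exists (x - y + z); first exact: is_latticeD latL _ _.
  by rewrite addrA [y + _]addrC subrK.
exists (z - (x - y)); first exact: is_latticeB latL _ _.
by rewrite opprB addrCA [x + _]addrC subrK addrC.
Qed.

(** If [z] lies in both balls, the parallelogram law for [z - y] and [z - x] bounds
    [dot (x - y) (x - y)] by twice the sum of their squared norms, which is below [4 * rho ^+ 2].
    This replaces the triangle inequality. *)
Lemma sphere_packing_dist V (A : set W) rho : 0 < rho ->
  A `<=` [set x | x \in V] ->
  (forall x y, A x -> A y -> x != y -> (2 * rho) ^+ 2 <= dot (x - y) (x - y)) ->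
  sphere_packing dot V A rho.
Proof.
move=> rho_gt0 AV distA; split=> // x y Ax Ay [z [[_ zx] [_ zy]]].
apply/eqP/negPn/negP => /(distA _ _ Ax Ay).
have ball_sqr t : enorm dot (z - t) < rho -> dot (z - t) (z - t) < rho ^+ 2.
  by rewrite -enorm_sqr ltr_pXn2r ?nnegrE ?sqrtr_ge0 // ltW.
have := dot_parallelogram (z - y) (z - x).
have -> : z - y - (z - x) = x - y by rewrite opprB addrC addrA subrK.
have := dot_ge0 (z - y + (z - x)).
have := ball_sqr _ zx; have := ball_sqr _ zy.
by rewrite exprMn; lra.
Qed.

End EuclideanSpace.

Unset Implicit Arguments.
Set Strict Implicit.

Theorem theorem1 (R : realType) (W : vectType R) (dot : {dot W for idfun})
    (n k l : nat) (Lambda : set W) (mu : R) (U V : {vspace W})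
    (s : nat) (u : 'I_s -> W) (beta : R) :
  let K := Lambda `&` [set x | x \in U] in
  let L := Lambda `&` [set x | x \in V] in
  let M := orthoproj dot U @` Lambda in
  let S := range u in
  let A := section_centers dot U V Lambda S in
  let rho := 2^-1 * Num.sqrt (mu - beta) in
  \dim {: W} = n ->
  is_lattice n Lambda ->
  minimal_norm dot Lambda mu ->
  (U + V)%VS = fullv ->
  directv (U + V) ->
  (U <= orthov dot V)%VS ->
  \dim U = k -> \dim V = l -> n = (k + l)%N ->
  is_lattice k K ->
  is_lattice l L ->
  injective u ->
  (forall i, M (u i)) ->
  0 <= beta -> beta < mu ->
  (forall i j, enorm dot (u i - u j) ^+ 2 <= beta) ->
  [/\ sphere_packing dot V A rho,
      periodic V L A
    & center_density dot V L A rho =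
        s%:R * rho ^+ l / Num.sqrt (lattice_det dot L)].
Proof.
move=> K L M S A rho _ latLambda [_ mu_min] UVfull /directv_addP UV0 UorthV.
move=> _ dimV _ _ latL u_inj Mu _ beta_mu u_beta.
have VorthU : (V <= orthov dot U)%VS by rewrite orthov_sym.
set pU := orthoproj dot U; set pV := orthoproj dot V.
have pUE : pU = daddv_pi U V.
  by rewrite /pU /orthoproj (orthov_complement UVfull).
have pVE : pV = daddv_pi V U.
  by rewrite /pV /orthoproj (@orthov_complement _ _ dot V U) // addvC.
have pUVK x : pU x + pV x = x by rewrite pUE pVE daddv_pi_add ?UVfull ?memvf.
have pU_in x : pU x \in U by rewrite pUE memv_pi.
have pV_in x : pV x \in V by rewrite pVE memv_pi.
(* Together with [pU0_V], this says that the kernel of [pU] is exactly [V], so its fibres on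
   [Lambda] are cosets of [L]. *)
have pU_V x : pU x = 0 -> x \in V by rewrite -{2}(pUVK x) => ->; rewrite add0r.
have pV_id x : x \in V -> pV x = x by move=> xV; rewrite pVE daddv_pi_id // capvC.
have pU0_V x : x \in V -> pU x = 0.
  by move=> xV; apply: (addIr (pV x)); rewrite pUVK add0r pV_id.
have pythagoras x : dot x x = dot (pU x) (pU x) + dot (pV x) (pV x).
  by rewrite -{1 2}(pUVK x) hnormDd //; move/orthovP: UorthV; apply.
have u_beta' i j : dot (u i - u j) (u i - u j) <= beta by rewrite -enorm_sqr.
have rho_gt0 : 0 < rho.
  by rewrite mulr_gt0 ?invr_gt0 ?ltr0n // sqrtr_gt0 subr_gt0.
have rho_sqr : (2 * rho) ^+ 2 = mu - beta.
  by rewrite /rho mulrA divff ?mul1r ?sqr_sqrtr ?subr_ge0 ?pnatr_eq0 // ltW.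
have packing : sphere_packing dot V A rho.
  apply: sphere_packing_dist => // [_ [w _ <-]|]; first exact: pV_in.
  move=> _ _ [w [Lw [i _ uiE]] <-] [w' [Lw' [j _ ujE]] <-] neq.
  rewrite rho_sqr lerBlDl.
  have ww' : w - w' != 0 by apply: contraNneq neq => /subr0_eq ->; apply: eqxx.
  apply: (le_trans (mu_min _ (is_latticeB latLambda Lw Lw') ww')).
  (* The [V]-parts cancel and the bound by [beta] on the [U]-part remains; it also covers
     [i = j]. *)
  by rewrite pythagoras (linearB pU) (linearB pV) /= lerD2r -/pU -uiE -ujE.
(* Fix one lift [w i] in [Lambda] of each [u i]; the vectors [pV (w i)] will represent the
   cosets. *)
have /choice[w wP] i : exists w, Lambda w /\ pU w = u i.
  by have [w] := Mu i; exists w.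
have AE : A = \bigcup_i translate (pV (w i)) L.
  apply/seteqP; split=> [_ [x [Lx [i _ uiE]] <-]|_ [i _ [y [Ly yV] <-]]].
    have [Lw pUw] := wP i.
    have xwV : x - w i \in V.
      by apply: pU_V; rewrite (linearB pU) /= pUw uiE subrr.
    exists i => //; exists (x - w i).
      by split=> //; apply: is_latticeB latLambda Lx Lw.
    by rewrite -[x - w i](pV_id _ xwV) (linearB pV) /= addrC subrK.
  have [Lw pUw] := wP i.
  exists (w i + y); last by rewrite linearD /= [pV y]pV_id.
  split; first exact: is_latticeD latLambda Lw Ly.
  by exists i => //; rewrite linearD /= [X in _ + X]pU0_V // addr0.
have coset_inj : injective (fun i => translate (pV (w i)) L).
  move=> i j /(translate_eqP _ _ latL)[Lij _].
  have [Lwi pUwi] := wP i; have [Lwj pUwj] := wP j.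
  apply: u_inj; apply/eqP; rewrite -subr_eq0; apply/negPn/negP => neq.
  (* The difference of the [V]-parts lies in [L], hence in [Lambda], so the right-hand side is a
     lattice vector. *)
  have uijE : u i - u j = w i - w j - (pV (w i) - pV (w j)).
    by rewrite -{1}(pUVK (w i)) -{1}(pUVK (w j)) pUwi pUwj opprD addrACA addrK.
  have := mu_min (u i - u j); rewrite {1}uijE => /(_ _ neq).
  have Luij := is_latticeB latLambda (is_latticeB latLambda Lwi Lwj) Lij.
  by move=> /(_ Luij); rewrite leNgt (le_lt_trans (u_beta' i j)).
(* [num_cosets] ranges over all centers, so each translate is first moved to its representative
   [pV (w i)]; [coset_inj] then gives exactly [s] of them. *)
have cosetsE :
    [set translate x L | x in A] = range (fun i => translate (pV (w i)) L).
  apply/seteqP; split=> [_ [x + <-]|_ [i _ <-]].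
    rewrite AE => -[i _ [y Ly <-]]; exists i => //.
    apply/(translate_eqP _ _ latL).
    by rewrite opprD addrA subrr; apply: is_latticeB latL (is_lattice0 latL) Ly.
  exists (pV (w i)) => //; rewrite AE; exists i => //.
  by exists 0; [exact: is_lattice0 latL|rewrite addr0].
split=> //.
- split; [by rewrite dimV|by move=> ? []|].
  exists (range (fun i => pV (w i))); first exact: finite_image.
  by rewrite AE bigcup_image.
rewrite /center_density dimV /num_cosets cosetsE.
rewrite (@card_fset_set _ _ s) //.
apply: card_eq_trans (card_esym card_II).
by apply: inj_card_eq => i j _ _ /coset_inj.
Qed.
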